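(* Let $\mathcal{M}=(E,\rho)$ be a $q$-polymatroid with denominator $\mu$. Let $V\in\mathcal{V}(E)$. Then \[ \rho(I)=\rho(V)\quad\text{for all }I\in\mathcal{B}_\mu(V). \] In particular, all $\mu$-bases of $V$ have the same rank value.
   Context: Throughout, $\mathbb{F}=\mathbb{F}_q$ is a finite field and $E$ is a finite-dimensional $\mathbb{F}$-vector space. $V\leq W$ means that $V$ is a subspace of $W$, and $\mathcal{V}(E)$ is the set of all subspaces of $E$. A $q$-rank function on $E$ is a map $\rho:\mathcal{V}(E)\to\mathbb{Q}_{\geq0}$ such that for all $V,W\in\mathcal{V}(E)$: (R1) $0\leq\rho(V)\leq\dim V$; (R2) $V\leq W$ implies $\rho(V)\leq\rho(W)$; (R3) $\rho(V+W)+\rho(V\cap W)\leq\rho(V)+\rho(W)$. A $q$-polymatroid on $E$ is a pair $\mathcal{M}=(E,\rho)$ with $\rho$ a $q$-rank function on $E$. A number $\mu\in\mathbb{Q}_{>0}$ is a denominator of $\mathcal{M}$ if $\mu\rho(V)\in\mathbb{N}_0$ for all $V\in\mathcal{V}(E)$. Let $\mathcal{M}=(E,\rho)$ be a $q$-polymatroid with denominator $\mu$. A space $I\in\mathcal{V}(E)$ is $\mu$-independent if $\rho(J)\geq\frac{\dim J}{\mu}$ for all subspaces $J\leq I$. For $V\in\mathcal{V}(E)$, set $\mathcal{I}_\mu(V)=\{I\in\mathcal{V}(E)\mid I \text{ is } \mu\text{-independent and } I\leq V\}$. A $\mu$-basis of $V$ is a space $\hat{I}\in\mathcal{I}_\mu(V)$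 with $\dim\hat{I}=\max\{\dim I\mid I\in\mathcal{I}_\mu(V)\}$; $\mathcal{B}_\mu(V)$ denotes the set of all $\mu$-bases of $V$. The rank value of a space $I$ is $\rho(I)$. *)

(* Defs.v *)
From mathcomp Require Import all_boot all_order all_algebra.

Set Implicit Arguments.
Unset Strict Implicit.
Unset Printing Implicit Defensive.

Import Order.TTheory GRing.Theory Num.Theory.
Local Open Scope ring_scope.

Definition q_rank_function (F : finFieldType) (E : vectType F)
    (rho : {vspace E} -> rat) : Prop :=
  [/\ forall V : {vspace E}, 0 <= rho V <= (\dim V)%:R,
      forall V W : {vspace E}, (V <= W)%VS -> rho V <= rho W
    & forall V W : {vspace E},
        rho (V + W)%VS + rho (V :&: W)%VS <= rho V + rho W].

Record q_polymatroid (F : finFieldType) (E : vectType F) : Type := QPolymatroid {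
  rank_fun :> {vspace E} -> rat;
  rank_funP : q_rank_function rank_fun
}.

Definition is_denominator (F : finFieldType) (E : vectType F)
    (M : q_polymatroid E) (mu : rat) : Prop :=
  0 < mu /\ forall V : {vspace E}, mu * M V \is a Num.nat.

Definition mu_independent (F : finFieldType) (E : vectType F)
    (M : q_polymatroid E) (mu : rat) (I : {vspace E}) : Prop :=
  forall J : {vspace E}, (J <= I)%VS -> (\dim J)%:R / mu <= M J.

Definition mu_independent_in (F : finFieldType) (E : vectType F)
    (M : q_polymatroid E) (mu : rat) (V I : {vspace E}) : Prop :=
  mu_independent M mu I /\ (I <= V)%VS.

(* [\dim I] is the maximum of the dimensions of the mu-independent subspaces
   of [V]: it is attained, by [I] itself, and it is an upper bound. *)
Definition mu_basis (F : finFieldType) (E : vectType F)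
    (M : q_polymatroid E) (mu : rat) (V I : {vspace E}) : Prop :=
  mu_independent_in M mu V I /\
  forall J : {vspace E}, mu_independent_in M mu V J -> (\dim J <= \dim I)%N.

(* Main.v *)
Require Import Defs.
From mathcomp Require Import all_boot all_order all_algebra.

(** Let [I] be a mu-basis of [V].  If adding a vector [x] of [V] to [I] raised
    the rank, then [I + <[x]>] would still be mu-independent
    ([mu_independent_add_line]): the rank gain, measured in units of [1 / mu],
    is a positive integer, hence pays for the one extra dimension.  The
    maximality of [\dim I] excludes this when [x] is not in [I], so no single
    vector of [V] raises the rank of [I].  By submodularity, vectors which do
    not raise the rank one at a time do not raise it together
    ([rank_add_span]), and adding a basis of [V] to [I] gives [V]. *)

Set Implicit Arguments.
Unset Strict Implicit.
Unset Printing Implicit Defensive.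

Import Order.TTheory GRing.Theory Num.Theory.
Local Open Scope ring_scope.

Lemma natr_ltD1 (R : archiRealDomainType) (a b : R) :
  a \is a Num.nat -> b \is a Num.nat -> a < b -> a + 1 <= b.
Proof. by move=> /natrP[m ->] /natrP[n ->]; rewrite natr1 ltr_nat ler_nat. Qed.

Section QPolymatroid.

Variables (F : finFieldType) (E : vectType F) (M : q_polymatroid E).
Implicit Types (I J U V W : {vspace E}) (x : E).

Lemma rank_le V W : (V <= W)%VS -> M V <= M W.
Proof. by case: (rank_funP M) => _ mono _; apply: mono. Qed.

Lemma rank_submod V W : M (V + W)%VS + M (V :&: W)%VS <= M V + M W.
Proof. by case: (rank_funP M). Qed.

(** [I] lies in the intersection of [I + <[x]>] and [I + <<s>>], so
    submodularity bounds the rank of their sum by that of [I]. *)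
Lemma rank_add_span I (s : seq E) :
  {in s, forall x, M (I + <[x]>)%VS <= M I} -> M (I + <<s>>)%VS <= M I.
Proof.
elim: s => [|x s IHs] rank_s; first by rewrite span_nil addv0.
have rank_x : M (I + <[x]>)%VS <= M I by apply: rank_s; rewrite mem_head.
have {}IHs : M (I + <<s>>)%VS <= M I.
  by apply: IHs => y ys; apply: rank_s; rewrite in_cons ys orbT.
have sub_cap : M I <= M ((I + <[x]>) :&: (I + <<s>>))%VS.
  by apply: rank_le; rewrite subv_cap !addvSl.
have := rank_submod (I + <[x]>)%VS (I + <<s>>)%VS.
have -> : (I + <[x]> + (I + <<s>>) = I + <<x :: s>>)%VS.
  by rewrite Monoid.mulmACA /= addvv span_cons.
move=> submod; rewrite -(lerD2r (M I)).
by apply: le_trans (lerD rank_x IHs); apply: le_trans submod; rewrite lerD2l.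
Qed.

Lemma dimv_add_line I x : (\dim (I + <[x]>) <= (\dim I).+1)%N.
Proof.
rewrite (leq_trans (dimv_add_leqif _ _)) // -addn1 leq_add2l dim_vline.
by case: (x == 0).
Qed.

(** For [J] not inside [I], [I + J] is all of [I + <[x]>], so by submodularity
    [J] inherits the rank gain over [I :&: J], which has codimension one in [J]
    and is mu-independent. *)
Lemma mu_independent_add_line mu I x :
    is_denominator M mu -> mu_independent M mu I ->
  M I < M (I + <[x]>)%VS -> mu_independent M mu (I + <[x]>)%VS.
Proof.
move=> [mu_gt0 mu_nat] indI gain J sJIx.
have [sJI | nsJI] := boolP (J <= I)%VS; first exact: indI.
have sIJ : (I + J <= I + <[x]>)%VS by rewrite subv_add addvSl.
have ltIJ : (\dim I < \dim (I + J)%VS)%N.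
  rewrite (ltn_leqif (dimv_leqif_sup (addvSl I J))).
  by rewrite subv_add subvv.
have dimIJ : \dim (I + J)%VS = (\dim I).+1.
  apply/eqP; rewrite eqn_leq ltIJ andbT.
  exact: leq_trans (dimvS sIJ) (dimv_add_line I x).
have eqIJ : (I + J = I + <[x]>)%VS.
  by apply/eqP; rewrite eqEdim sIJ dimIJ dimv_add_line.
have dimJ : \dim J = (\dim (I :&: J)).+1.
  have := dimv_sum_cap I J; rewrite dimIJ addSnnS => /eqP.
  by rewrite eqn_add2l => /eqP.
have gainJ : M (I :&: J)%VS < M J.
  have := rank_submod I J; rewrite eqIJ => submod.
  rewrite -(ltrD2l (M I)); apply: lt_le_trans submod.
  by rewrite ltrD2r.
have := indI _ (capvSl I J); rewrite !ler_pdivrMr // ![_ * mu]mulrC => dim_cap.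
apply: le_trans (natr_ltD1 (mu_nat (I :&: J)%VS) (mu_nat J) _).
  by rewrite dimJ -natr1 lerD2r.
by rewrite ltr_pM2l.
Qed.

Lemma mu_basis_rank_add_line mu V I x :
    is_denominator M mu -> mu_basis M mu V I -> x \in V ->
  M (I + <[x]>)%VS <= M I.
Proof.
move=> hmu [[indI sIV] maxI] xV; rewrite leNgt; apply/negP => gain.
have sIxV : (I + <[x]> <= V)%VS by rewrite subv_add sIV -memvE.
have dim_le := maxI _ (conj (mu_independent_add_line hmu indI gain) sIxV).
have eqI : (I = I + <[x]>)%VS by apply/eqP; rewrite eqEdim addvSl.
by rewrite -eqI ltxx in gain.
Qed.

Lemma mu_basis_rank mu V I :
  is_denominator M mu -> mu_basis M mu V I -> M I = M V.
Proof.
move=> hmu basI; have [[_ sIV] _] := basI.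
apply/le_anti; rewrite rank_le //=.
have IV : (I + <<vbasis V>> = V)%VS.
  by rewrite (span_basis (vbasisP V)); apply/addv_idPr.
rewrite -{1}IV; apply: rank_add_span => x /vbasis_mem.
exact: mu_basis_rank_add_line hmu basI.
Qed.

End QPolymatroid.

Theorem theorem4p2 (F : finFieldType) (E : vectType F) (M : q_polymatroid E)
    (mu : rat) (hmu : is_denominator M mu) (V : {vspace E}) :
  (forall I : {vspace E}, mu_basis M mu V I -> M I = M V) /\
  (forall I J : {vspace E}, mu_basis M mu V I -> mu_basis M mu V J -> M I = M J).
Proof.
split=> [I|I J basI basJ]; first exact: mu_basis_rank.
by rewrite (mu_basis_rank hmu basI) (mu_basis_rank hmu basJ).
Qed.
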